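(* Every upper stable metric space has property $\mathcal{Q}$.
   Context: For a set $M\subseteq\mathbb{N}$ and $k\ge0$, $[M]^k$ is the set of $k$-element subsets of $M$, written as increasing tuples $\bar n=(n_1,\dots,n_k)$, $n_1<\dots<n_k$; $[k]=\{1,\dots,k\}$. Upper stability: a metric space $(X,d_X)$ is $K_u$-upper stable ($K_u>0$) if for every $k\ge1$, every $1\le\ell\le k$, every permutation $\pi\colon[k]\to[k]$ which preserves the order on $\{1,\dots,\ell\}$ and on $\{\ell+1,\dots,k\}$, all bounded maps $f\colon[\mathbb{N}]^\ell\to X$ and $g\colon[\mathbb{N}]^{k-\ell}\to X$, and every infinite $M\subseteq\mathbb{N}$, $$\inf_{\bar n\in[M]^k}d_X\big(f(n_1,\dots,n_\ell),g(n_{\ell+1},\dots,n_k)\big)\le K_u\sup_{\bar n\in[M]^k}d_X\big(f(n_{\pi(1)},\dots,n_{\pi(\ell)}),g(n_{\pi(\ell+1)},\dots,n_{\pi(k)})\big).$$ It is upper stable if it is $K_u$-upper stable for some $K_u>0$. Interlacing graphs: for $k\ge1$, distinct $\bar m,\bar n\in[\mathbb{N}]^k$ are adjacent if $m_1\le n_1\le m_2\le n_2\le\dots\le m_k\le n_k$ or $n_1\le m_1\le n_2\le m_2\le\dots\le n_k\le m_k$; $d_I$ denotes the resulting graph (shortest path) metric on $[\mathbb{N}]^k$. Property $\mathcal{Q}$: a metric space $(X,d_X)$ has property $\mathcal{Q}$ if there is a constant $C>0$ such that for every $k\ge1$ and every Lipschitz map $f\colon([\mathbb{N}]^k,d_I)\to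 X$ there is an infinite subset $M$ of $\mathbb{N}$ such that $d_X(f(\bar m),f(\bar n))\le C\cdot\mathrm{Lip}(f)$ for all $\bar m,\bar n\in[M]^k$, where $\mathrm{Lip}(f)$ is the Lipschitz constant of $f$. *)

(* Defs.v *)
From HB Require Import structures.
From mathcomp Require Import all_boot all_order all_algebra all_fingroup.
From mathcomp Require Import boolp classical_sets cardinality reals.
From mathcomp Require Import topology.

Set Implicit Arguments.
Unset Strict Implicit.
Unset Printing Implicit Defensive.

Import Order.TTheory GRing.Theory Num.Theory.
Local Open Scope classical_set_scope.
Local Open Scope ring_scope.

(* The k-element subsets of nat, written as increasing k-tuples. *)
Record ksub (k : nat) : Type := KSub {
  ksub_tuple : k.-tuple nat;
  _ : sorted ltn ksub_tuple
}.

HB.instance Definition _ k := [isSub for @ksub_tuple k].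
HB.instance Definition _ k := [Countable of ksub k by <:].

(* [n i] is the entry of index [i] of [n]; indices start at 0. *)
Definition ksub_entry k (n : ksub k) (i : 'I_k) : nat := tnth (ksub_tuple n) i.
Coercion ksub_entry : ksub >-> Funclass.

Definition ksub_of k (M : set nat) : set (ksub k) :=
  [set n | forall i, M (n i)].

Lemma ksub_lt k (n : ksub k) (i j : 'I_k) : (i < j)%N -> (n i < n j)%N.
Proof.
move=> ij; rewrite /ksub_entry !(tnth_nth 0%N).
have /(sorted_ltn_nth ltn_trans 0%N) := valP n.
by apply=> //; rewrite inE size_tuple.
Qed.

Lemma ksubP k (n n' : ksub k) : n =1 n' -> n = n'.
Proof. by move=> nn'; apply/val_inj/eq_from_tnth. Qed.

Definition increasing_index k l (s : 'I_l -> 'I_k) : Prop :=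
  forall i j : 'I_l, (i < j)%N -> (s i < s j)%N.

Lemma mk_ksub_subproof l (s : 'I_l -> nat)
    (hs : forall i j : 'I_l, (i < j)%N -> (s i < s j)%N) :
  sorted ltn [tuple s i | i < l].
Proof.
have homo_s : {homo s : i j / (i < j)%N} by [].
rewrite /= /codom /image_mem (homo_sorted homo_s)//.
rewrite -(@sorted_map _ _ (@nat_of_ord l) ltn) val_enum_ord.
exact: iota_ltn_sorted.
Qed.

Definition mk_ksub l (s : 'I_l -> nat)
    (hs : forall i j : 'I_l, (i < j)%N -> (s i < s j)%N) : ksub l :=
  KSub (mk_ksub_subproof hs).

Lemma mk_ksubE l (s : 'I_l -> nat) hs (i : 'I_l) : @mk_ksub l s hs i = s i.
Proof. by rewrite /ksub_entry tnth_mktuple. Qed.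

(* (n_{s(1)}, ..., n_{s(l)}) *)
Definition ksub_reindex k l (s : 'I_l -> 'I_k) (hs : increasing_index s)
    (n : ksub k) : ksub l :=
  mk_ksub (fun i j ij => ksub_lt n (hs i j ij)).

Lemma lshift_increasing l m : increasing_index (@lshift l m).
Proof. by []. Qed.

Lemma rshift_increasing l m : increasing_index (@rshift l m).
Proof. by move=> i j ij; rewrite /= ltn_add2l. Qed.

Definition bounded_map (R : realType) (X : metricType R) (T : Type)
    (f : T -> X) : Prop :=
  exists B : R, forall s t, mdist (f s) (f t) <= B.

(* The index k of the tuples is written k = l + m, with l >= 1 and m >= 0, so
   that {1, ..., l} is the image of [lshift m] and {l+1, ..., k} that of
   [rshift l]; the case l = k is m = 0. Since f and g are bounded, and M is
   infinite, [inf] and [sup] are taken over nonempty bounded sets. *)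
Definition upper_stable_with (R : realType) (X : metricType R) (Ku : R)
    : Prop :=
  forall (l m : nat) (pi : 'S_(l + m))
    (pi_l : increasing_index (fun i : 'I_l => pi (lshift m i)))
    (pi_m : increasing_index (fun j : 'I_m => pi (rshift l j)))
    (f : ksub l -> X) (g : ksub m -> X) (M : set nat),
  (1 <= l)%N -> bounded_map f -> bounded_map g -> infinite_set M ->
  inf [set mdist (f (ksub_reindex (@lshift_increasing l m) n))
                 (g (ksub_reindex (@rshift_increasing l m) n))
      | n in @ksub_of (l + m) M]
  <= Ku * sup [set mdist (f (ksub_reindex pi_l n)) (g (ksub_reindex pi_m n))
              | n in @ksub_of (l + m) M].

Definition upper_stable (R : realType) (X : metricType R) : Prop :=
  exists2 Ku : R, 0 < Ku & @upper_stable_with R X Ku.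

(* m_1 <= n_1 <= m_2 <= n_2 <= ... <= m_k <= n_k *)
Definition interlaced k (m n : ksub k) : bool :=
  [forall i, m i <= n i]%N &&
  [forall i : 'I_k, forall j : 'I_k, (i.+1 == j :> nat) ==> (n i <= m j)]%N.

Definition interlacing_adj k (m n : ksub k) : bool :=
  (m != n) && (interlaced m n || interlaced n m).

Definition walk_of_length k (m n : ksub k) (d : nat) : Prop :=
  exists p : seq (ksub k),
    [/\ path (@interlacing_adj k) m p, last m p = n & size p = d].

Lemma interlacing_adjC k : symmetric (@interlacing_adj k).
Proof. by move=> m n; rewrite /interlacing_adj eq_sym orbC. Qed.

Lemma walk_cat k (m n p : ksub k) d e :
  walk_of_length m n d -> walk_of_length n p e -> walk_of_length m p (d + e).
Proof.
move=> [s [ps ls <-]] [t [pt lt <-]]; exists (s ++ t).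
by rewrite cat_path last_cat size_cat ps ls.
Qed.

Lemma walk_sym k (m n : ksub k) d :
  walk_of_length m n d -> walk_of_length n m d.
Proof.
move=> [s [ps ls sd]]; exists (rev (belast m s)); split.
- rewrite -ls rev_path; apply: sub_path ps => x y.
  by rewrite interlacing_adjC.
- by case: s ps ls sd => [|y s] //= _ _ _; rewrite rev_cons last_rcons.
- by rewrite size_rev size_belast.
Qed.

Lemma window_increasing k (w : nat -> nat) (hw : {homo w : i j / (i < j)%N})
    (a : nat) (i j : 'I_k) : (i < j)%N -> (w (a + i) < w (a + j))%N.
Proof. by move=> ij; apply: hw; rewrite ltn_add2l. Qed.

Definition window k (w : nat -> nat) (hw : {homo w : i j / (i < j)%N})
    (a : nat) : ksub k :=
  mk_ksub (window_increasing (k := k) hw a).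

Lemma window_walk k (w : nat -> nat) (hw : {homo w : i j / (i < j)%N}) a :
  exists d, walk_of_length (window k hw 0) (window k hw a) d.
Proof.
elim: a => [|a [d hd]]; first by exists 0%N, [::].
case: k hd => [|k] hd.
  by exists d; suff <- : window 0 hw a = window 0 hw a.+1
    by []; apply: ksubP => -[].
exists (d + 1)%N; apply: walk_cat hd _; exists [:: window k.+1 hw a.+1].
split=> //=; rewrite andbT /interlacing_adj; apply/andP; split.
  apply/eqP => /(congr1 (fun n : ksub k.+1 => n ord0)).
  by rewrite !mk_ksubE !addn0 => e; have := hw _ _ (ltnSn a); rewrite e ltnn.
apply/orP; left; apply/andP; split.
  by apply/forallP => i; rewrite !mk_ksubE ltnW// hw// addSn.
apply/forallP => i; apply/forallP => j; apply/implyP => /eqP ij.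
by rewrite !mk_ksubE -ij addnS addSn.
Qed.

Lemma interlacing_connected k (m n : ksub k) :
  exists d, walk_of_length m n d.
Proof.
pose L := ((\max_i m i) + (\max_i n i)).+1.
pose w (x : ksub k) a := if insub a is Some i then x i else (L + a)%N.
have wlt (x : ksub k) : (forall i, x i < L)%N -> {homo w x : i j / (i < j)%N}.
  move=> xL i j ij; rewrite /w.
  case: insubP => [i' _ ii'|]; case: insubP => [j' _ jj'|].
  - by apply: ksub_lt; rewrite ii' jj'.
  - by move=> _; apply: leq_trans (xL i') (leq_addr _ _).
  - by move=> /negP[]; apply: (ltn_trans ij); rewrite -jj'; apply: ltn_ord.
  - by rewrite ltn_add2l.
have mL i : (m i < L)%N by rewrite ltnS (leq_trans (leq_bigmax i)) ?leq_addr.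
have nL i : (n i < L)%N by rewrite ltnS (leq_trans (leq_bigmax i)) ?leq_addl.
have w0 x xL : window k (wlt x xL) 0 = x.
  by apply: ksubP => i; rewrite mk_ksubE /w add0n valK.
have [d hd] := window_walk k (wlt m mL) k.
have [e he] := window_walk k (wlt n nL) k.
exists (d + e)%N; rewrite !w0 in hd he; apply: walk_cat hd _.
suff -> : window k (wlt m mL) k = window k (wlt n nL) k by exact: walk_sym.
by apply: ksubP => i; rewrite !mk_ksubE /w insubN// -leqNgt leq_addr.
Qed.

Lemma interlacing_walk_ex k (m n : ksub k) :
  exists d, `[< walk_of_length m n d >].
Proof.
by have [d hd] := interlacing_connected m n; exists d; apply/asboolP.
Qed.

(* Shortest path metric; the graph is connected, so no default value is needed. *)
Definition interlacing_dist k (m n : ksub k) : nat :=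
  ex_minn (interlacing_walk_ex m n).

Definition is_lipschitz (R : realType) (X : metricType R) k
    (f : ksub k -> X) : Prop :=
  exists L : R, forall m n : ksub k,
    mdist (f m) (f n) <= L * (interlacing_dist m n)%:R.

Definition Lip (R : realType) (X : metricType R) k (f : ksub k -> X) : R :=
  sup [set mdist (f mn.1) (f mn.2) / (interlacing_dist mn.1 mn.2)%:R
      | mn in [set mn : ksub k * ksub k | mn.1 != mn.2]].

Definition property_Q (R : realType) (X : metricType R) : Prop :=
  exists2 C : R, 0 < C &
    forall (k : nat) (f : ksub k -> X), (1 <= k)%N -> is_lipschitz f ->
    exists2 M : set nat, infinite_set M &
      forall m n : ksub k, ksub_of M m -> ksub_of M n ->
        mdist (f m) (f n) <= C * Lip f.

(* Main.v *)
Require Import Defs.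
From mathcomp Require Import all_boot all_order all_algebra.
From mathcomp Require Import all_fingroup boolp classical_sets cardinality.
From mathcomp Require Import reals topology.

(** Let [f] be Lipschitz on the [k]-subsets of nat. It is bounded, because the
interlacing metric is. Upper stability is used only with [l = m = k], [f = g]
and the permutation that interleaves the two halves of a [2k]-subset [n]: then
[f] is compared at the interlaced sets [(n_1, n_3, ...)] and [(n_2, n_4, ...)],
so that the supremum is at most [Lip f] ([interleaved_interlaced],
[interlaced_mdist_le]). Hence in every infinite set [M] there are [2k]-subsets
[n] for which [f (n_1, ..., n_k)] and [f (n_{k+1}, ..., n_{2k})] are at distance
close to [Ku * Lip f] at most. By the infinite Ramsey theorem ([ramsey_ksub])
there is an infinite [M] such that this distance is at most [2 * Ku * Lip f]
for all [2k]-subsets [n] of [M], the opposite alternative being excluded when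
[Lip f] is positive; when [Lip f = 0] the map [f] is constant. Two [k]-subsets
of [M] both lie to the left of some third one, and the triangle inequality
gives property Q with the constant [4 * Ku]. *)

Set Implicit Arguments.
Unset Strict Implicit.
Unset Printing Implicit Defensive.

Import Order.TTheory GRing.Theory Num.Theory.
Local Open Scope classical_set_scope.
Local Open Scope ring_scope.

(** * Infinite sets of natural numbers *)

Lemma infinite_natP (M : set nat) :
  infinite_set M <-> forall n, exists2 m, M m & (n < m)%N.
Proof.
split=> [infM n|unbM /finite_seqP[s Ms]].
  apply: contrapT => noM; apply: infM.
  apply: (@sub_finite_set _ _ `I_n.+1); last exact: finite_II.
  move=> m Mm /=; rewrite ltnS leqNgt; apply/negP => nm.
  by apply: noM; exists m.
have [m Mm] := unbM (\max_(i <- s) i)%N; rewrite ltnNge.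
by rewrite Ms /= in Mm; rewrite (@leq_bigmax_seq _ s xpredT (fun i => i) m).
Qed.

Lemma infinite_fiber (T : finType) (b : nat -> T) :
  exists t, infinite_set [set i | b i = t].
Proof.
apply: contrapT => /forallNP finb; apply: infinite_nat.
rewrite (_ : setT = \bigcup_(t in setT) [set i | b i = t]); last first.
  by apply/seteqP; split=> i // _; exists (b i).
apply: bigcup_finite => [|t _]; first exact: finite_finset.
exact: contrapT (finb t).
Qed.

(** The infinite Ramsey theorem, for colourings of the increasing sequences of
length [k] by a finite type of colours. In the induction step one builds
elements [a i] of decreasing infinite sets [S i] such that the colour of
[a i :: s], for [s] in [S i.+1], depends on [i] only. *)
Lemma ramsey_seq (T : finType) k (c : seq nat -> T) (M : set nat) :
  infinite_set M ->
  exists t, exists2 N : set nat, infinite_set N /\ N `<=` M &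
    forall s, sorted ltn s -> size s = k -> {in s, forall y, N y} -> c s = t.
Proof.
elim: k c M => [|k IHk] c M infM.
  by exists (c [::]), M; [split|move=> s _ /size0nil ->].
pose st := {S : set nat | infinite_set S}.
(* For an infinite set S, the triple p consists of an element of S, a colour
   and an infinite subset of S on which the colour is constant. *)
have step (S : st) : exists p : nat * T * st,
    [/\ sval S p.1.1, sval p.2 `<=` sval S,
        forall y, sval p.2 y -> (p.1.1 < y)%N &
        forall s, sorted ltn s -> size s = k ->
          {in s, forall y, sval p.2 y} -> c (p.1.1 :: s) = p.1.2].
  case: S => S infS /=.
  have [a Sa _] := (infinite_natP S).1 infS 0%N.
  have infS' : infinite_set [set y | S y /\ (a < y)%N].
    apply/infinite_natP => n.
    have [y Sy] := (infinite_natP S).1 infS (maxn n a).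
    by rewrite gtn_max => /andP[ny ay]; exists y.
  have [t [N [infN NS] ct]] := IHk (fun s => c (a :: s)) _ infS'.
  by exists (a, t, exist _ N infN); split=> //= y /NS[].
have [F FP] := choice step.
pose S i := iter i (fun S => (F S).2) (exist _ M infM : st).
pose a i := (F (S i)).1.1.
have S_anti i j : (i <= j)%N -> sval (S j) `<=` sval (S i).
  move=> /subnK <-; elim: (j - i)%N => //= d; apply: subset_trans.
  by have [] := FP (S (d + i)%N).
have Sa i : sval (S i) (a i) by have [] := FP (S i).
have a_lt : {homo a : i j / (i < j)%N}.
  move=> i j ij; have [_ _ + _] := FP (S i).
  by apply; apply: (S_anti i.+1 j ij).
have a_mono : {mono a : i j / (i < j)%N}.
  by apply: leqW_mono; apply: leq_mono.
have le_a i : (i <= a i)%N.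
  by elim: i => // i IHi; apply: leq_ltn_trans IHi (a_lt _ _ _).
have [t inft] := infinite_fiber (fun i => (F (S i)).1.2).
exists t, (a @` [set i | (F (S i)).1.2 = t]); first split.
- apply/infinite_natP => n; have [i ti ni] := (infinite_natP _).1 inft n.
  by exists (a i); [exists i|apply: leq_trans (le_a i)].
- by move=> _ [i _ <-]; apply: (S_anti 0%N i).
- case=> [|x s] //= s_sorted [sz_s] sN.
  have [i <- xa] := sN x (mem_head x s); have [_ _ _ cF] := FP (S i).
  rewrite -xa; apply: cF => //; first exact: path_sorted s_sorted.
  move=> y ys; have [j _ ya] := sN y (@mem_behead _ (x :: s) y ys).
  have := allP (order_path_min ltn_trans s_sorted) y ys.
  rewrite -xa -ya a_mono => ij; exact: (S_anti i.+1 j ij).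
Qed.

Lemma ksub_ofE k (M : set nat) (x : ksub k) :
  ksub_of M x <-> {in (ksub_tuple x : seq nat), forall y, M y}.
Proof.
split=> [Mx y /tnthP[i ->]|Mx i]; first exact: Mx.
exact: (Mx _ (mem_tnth i (ksub_tuple x))).
Qed.

Lemma ramsey_ksub k (P : set (ksub k)) (M : set nat) :
  infinite_set M ->
  exists2 N : set nat, infinite_set N /\ N `<=` M &
    ksub_of N `<=` P \/ ksub_of N `<=` ~` P.
Proof.
move=> infM.
(* Sequences that are not increasing of length k get the colour false. *)
pose c (s : seq nat) := `[< exists2 x, P x & ksub_tuple x = s :> seq nat >].
have [b [N infN cN]] := ramsey_seq k c infM.
exists N => //.
have {}cN (x : ksub k) : ksub_of N x -> c (ksub_tuple x) = b.
  by move=> /ksub_ofE Nx; apply: cN; [exact: (valP x)|rewrite size_tuple|].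
case: b cN => cN; [left|right] => x /cN.
  by move=> /asboolP[y Py /val_inj/val_inj <-].
by move=> /asboolPn + Px; apply; exists x.
Qed.

Lemma ksub_above k (M : set nat) (a : nat) : infinite_set M ->
  exists2 x : ksub k, ksub_of M x & forall i, (a < x i)%N.
Proof.
move=> infM.
have [s [s_path sz_s sM]] : exists s, [/\ path ltn a s, size s = k &
    {in s, forall y, M y}].
  elim: k a => [|k IHk] a; first by exists [::].
  have [y My ay] := (infinite_natP M).1 infM a.
  have [s [s_path sz_s sM]] := IHk y; exists (y :: s).
  split=> /=; [by rewrite ay|by rewrite sz_s|].
  by move=> z; rewrite inE => /predU1P[-> //|]; apply: sM.
have sz_s' : size s == k by apply/eqP.
exists (@KSub k (Tuple sz_s') (path_sorted s_path)); first exact/ksub_ofE.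
by move=> i; apply: (allP (order_path_min ltn_trans s_path)); apply: mem_tnth.
Qed.

Lemma ksub_bounded k (x : ksub k) : exists a, forall i, (x i <= a)%N.
Proof. by exists (\max_i x i)%N => i; apply: leq_bigmax. Qed.

(** * Concatenating and interleaving *)

(** The entries of [x] followed by those of [y]; they are those of a set in
[ksub (k + l)] when every entry of [x] is smaller than every entry of [y]. *)
Definition cat_entry k l (x : ksub k) (y : ksub l) (i : 'I_(k + l)) : nat :=
  match split i with inl i1 => x i1 | inr i2 => y i2 end.

Lemma cat_entry_lshift k l (x : ksub k) (y : ksub l) i :
  cat_entry x y (lshift l i) = x i.
Proof. by rewrite /cat_entry (unsplitK (inl i : 'I_k + 'I_l)). Qed.

Lemma cat_entry_rshift k l (x : ksub k) (y : ksub l) i :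
  cat_entry x y (rshift k i) = y i.
Proof. by rewrite /cat_entry (unsplitK (inr i : 'I_k + 'I_l)). Qed.

Lemma cat_entry_lt k l (x : ksub k) (y : ksub l) :
  (forall i j, (x i < y j)%N) ->
  forall i j : 'I_(k + l), (i < j)%N -> (cat_entry x y i < cat_entry x y j)%N.
Proof.
move=> xy i j; case: (split_ordP i) => i' ->; case: (split_ordP j) => j' -> /=.
all: rewrite ?(cat_entry_lshift, cat_entry_rshift).
- exact: ksub_lt.
- by move=> _; apply: xy.
- by move=> /ltnW; rewrite leqNgt (leq_trans (ltn_ord j') (leq_addr _ _)).
- by rewrite ltn_add2l; apply: ksub_lt.
Qed.

Lemma interleave_bound_even k (i : 'I_k) : (i.*2 < k + k)%N.
Proof. by rewrite addnn ltn_double. Qed.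

Lemma interleave_bound_odd k (i : 'I_k) : (i.*2.+1 < k + k)%N.
Proof. by rewrite addnn -doubleS ltn_Sdouble. Qed.

(** The map on indices that sends the first half to the even positions and the
second half to the odd ones, both in increasing order; positions are counted
from 0. *)
Definition interleave k (i : 'I_(k + k)) : 'I_(k + k) :=
  match split i with
  | inl i1 => Ordinal (interleave_bound_even i1)
  | inr i2 => Ordinal (interleave_bound_odd i2)
  end.

Lemma interleave_lshift k (i : 'I_k) : interleave (lshift k i) = i.*2 :> nat.
Proof. by rewrite /interleave (unsplitK (inl i : 'I_k + 'I_k)). Qed.

Lemma interleave_rshift k (i : 'I_k) :
  interleave (rshift k i) = i.*2.+1 :> nat.
Proof. by rewrite /interleave (unsplitK (inr i : 'I_k + 'I_k)). Qed.

Lemma interleave_inj k : injective (@interleave k).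
Proof.
move=> i j; case: (split_ordP i) => i' ->; case: (split_ordP j) => j' ->.
all: move=> /(congr1 val) /=.
all: rewrite ?(interleave_lshift, interleave_rshift) => e.
- by congr lshift; apply: val_inj; apply: double_inj.
- by have := congr1 odd e; rewrite /= !odd_double.
- by have := congr1 odd e; rewrite /= !odd_double.
- by congr rshift; apply: val_inj; apply: double_inj; case: e.
Qed.

Definition interleave_perm k : 'S_(k + k) := perm (@interleave_inj k).

Lemma interleave_perm_l k :
  increasing_index (fun i : 'I_k => interleave_perm k (lshift k i)).
Proof. by move=> i j ij; rewrite !permE !interleave_lshift ltn_double. Qed.

Lemma interleave_perm_r k :
  increasing_index (fun i : 'I_k => interleave_perm k (rshift k i)).
Proof.
by move=> i j ij; rewrite !permE !interleave_rshift ltnS ltn_double.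
Qed.

Lemma interleaved_interlaced k (n : ksub (k + k)) :
  interlaced (ksub_reindex (@interleave_perm_l k) n)
             (ksub_reindex (@interleave_perm_r k) n).
Proof.
apply/andP; split; apply/forallP => i; last (apply/forallP => j; apply/implyP).
  rewrite !mk_ksubE ltnW// ksub_lt// !permE.
  by rewrite interleave_lshift interleave_rshift.
move=> /eqP ij; rewrite !mk_ksubE ltnW// ksub_lt// !permE.
by rewrite interleave_lshift interleave_rshift -ij doubleS.
Qed.

(** * Lipschitz maps on the interlacing graph *)

Section lipschitz.
Variables (R : realType) (X : metricType R) (k : nat) (f : ksub k -> X).

Lemma interlacing_dist_walk (m n : ksub k) d :
  walk_of_length m n d -> (interlacing_dist m n <= d)%N.
Proof.
move=> mn; rewrite /interlacing_dist; case: ex_minnP => e _; apply.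
exact/asboolP.
Qed.

Lemma interlacing_dist_eq0 (m n : ksub k) :
  interlacing_dist m n = 0%N -> m = n.
Proof.
rewrite /interlacing_dist; case: ex_minnP => d /asboolP mn _ d0.
by move: mn; rewrite d0 => -[p [_ + /size0nil p0]]; rewrite p0.
Qed.

Hypothesis f_lip : is_lipschitz f.

Lemma mdist_le_Lip (m n : ksub k) :
  mdist (f m) (f n) <= Lip f * (interlacing_dist m n)%:R.
Proof.
have [->|mn] := eqVneq m n.
  have := @interlacing_dist_walk n n 0%N.
  rewrite leqn0 => /(_ _)/eqP ->; last by exists [::].
  by rewrite mdistxx mulr0.
have dist_gt0 (x y : ksub k) : x != y -> 0 < (interlacing_dist x y)%:R :> R.
  rewrite ltr0n lt0n => xy; apply/eqP => /interlacing_dist_eq0 exy.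
  by rewrite exy eqxx in xy.
rewrite -ler_pdivrMr ?dist_gt0//; apply: ub_le_sup; last by exists (m, n).
have [L fL] := f_lip; exists L => _ [[x y] /= xy <-].
by rewrite ler_pdivrMr ?dist_gt0.
Qed.

Lemma Lip_ge0 : 0 <= Lip f.
Proof.
rewrite /Lip; set E := [set _ | _ in _].
have [[[x Ex] ubE]|/sup_out -> //] := pselect (has_sup E).
apply: le_trans (ub_le_sup ubE Ex).
by case: Ex => mn _ <-; rewrite divr_ge0 ?mdist_ge0.
Qed.

Lemma interlaced_mdist_le (m n : ksub k) :
  interlaced m n -> mdist (f m) (f n) <= Lip f.
Proof.
move=> mn; apply: le_trans (mdist_le_Lip m n) _.
rewrite -[leRHS]mulr1 ler_wpM2l ?Lip_ge0// -[1]/(1%:R) ler_nat.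
have [->|neq_mn] := eqVneq m n.
  by apply: leq_trans (@interlacing_dist_walk n n 0%N _) _ => //; exists [::].
apply: interlacing_dist_walk; exists [:: n]; split=> //=.
by rewrite /interlacing_adj neq_mn mn.
Qed.

Lemma mdist_window_le (w : nat -> nat) (hw : {homo w : i j / (i < j)%N}) a :
  mdist (f (window k hw 0)) (f (window k hw a)) <= Lip f * a%:R.
Proof.
elim: a => [|a IHa]; first by rewrite mdistxx mulr0.
apply: le_trans (metric_triangle _ (f (window k hw a)) _) _.
rewrite -natr1 mulrDr mulr1 lerD//; apply: interlaced_mdist_le.
apply/andP; split; first by apply/forallP => i; rewrite !mk_ksubE ltnW ?hw ?addSn.
apply/forallP => i; apply/forallP => j; apply/implyP => /eqP ij.
by rewrite !mk_ksubE -ij addnS addSn.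
Qed.

(** Continuing each of two [k]-subsets by the same far away numbers and sliding
a window of length [k], one reaches the same [k]-subset after [k] interlacing
steps. *)
Lemma lipschitz_bounded : bounded_map f.
Proof.
exists (Lip f * k%:R + Lip f * k%:R) => m n.
have [a ma] := ksub_bounded m; have [b nb] := ksub_bounded n.
pose L := (maxn a b).+1.
pose w (x : ksub k) i := if insub i is Some j then x j else (L + i)%N.
have w_lt (x : ksub k) : (forall i, x i < L)%N -> {homo w x : i j / (i < j)%N}.
  move=> xL i j ij; rewrite /w.
  case: insubP => [i' _ ii'|]; case: insubP => [j' _ jj'|] //.
  - by apply: ksub_lt; rewrite ii' jj'.
  - by move=> _; apply: leq_trans (xL i') (leq_addr _ _).
  - by move=> /negP[]; apply: (ltn_trans ij); rewrite -jj'; apply: ltn_ord.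
  - by rewrite ltn_add2l.
have mL i : (m i < L)%N by rewrite ltnS leq_max ma.
have nL i : (n i < L)%N by rewrite ltnS leq_max nb orbT.
have w0 x xL : window k (w_lt x xL) 0 = x.
  by apply: ksubP => i; rewrite mk_ksubE /w add0n valK.
have wk : window k (w_lt n nL) k = window k (w_lt m mL) k.
  by apply: ksubP => i; rewrite !mk_ksubE /w insubN// -leqNgt leq_addr.
rewrite -{1}(w0 m mL) -{1}(w0 n nL).
apply: le_trans (metric_triangle _ (f (window k (w_lt m mL) k)) _) _.
rewrite lerD ?mdist_window_le// -wk metric_sym; exact: mdist_window_le.
Qed.

End lipschitz.

(** * Upper stability and property Q *)

(** Upper stability rules out that the distance exceeds [r] for all pairs of
successive [k]-subsets of an infinite set, which is the other alternative in
Ramsey's theorem. *)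
Lemma upper_stable_homogeneous (R : realType) (X : metricType R) (Ku r : R)
    k (f : ksub k -> X) :
  0 < Ku -> upper_stable_with X Ku -> (1 <= k)%N -> is_lipschitz f ->
  Ku * Lip f < r ->
  exists2 M : set nat, infinite_set M &
    forall m n, ksub_of M m -> ksub_of M n -> (forall i j, (m i < n j)%N) ->
      mdist (f m) (f n) <= r.
Proof.
move=> Ku0 stable k1 f_lip lt_r.
pose d (n : ksub (k + k)) := mdist (f (ksub_reindex (@lshift_increasing k k) n))
                                   (f (ksub_reindex (@rshift_increasing k k) n)).
have [M [infM _] [Mr|Mr]] :=
    ramsey_ksub [set n | d n <= r] infinite_nat; exists M => //.
  move=> m n Mm Mn mn; pose mn' := mk_ksub (cat_entry_lt mn).
  have /Mr : ksub_of M mn'.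
    move=> i; rewrite mk_ksubE; case: (split_ordP i) => j ->.
      by rewrite cat_entry_lshift.
    by rewrite cat_entry_rshift.
  rewrite /= /d; congr (mdist (f _) (f _) <= _); apply: ksubP => i.
    by rewrite !mk_ksubE cat_entry_lshift.
  by rewrite !mk_ksubE cat_entry_rshift.
have [x Mx _] := ksub_above (k + k) 0 infM.
have f_bnd := lipschitz_bounded f_lip.
have := stable k k _ (@interleave_perm_l k) (@interleave_perm_r k) f f M
  k1 f_bnd f_bnd infM.
rewrite leNgt => /negP[]; apply: (@lt_le_trans _ _ r).
  apply: le_lt_trans lt_r; rewrite ler_pM2l//; apply: ge_sup.
    by eexists; exists x.
  move=> _ [n _ <-]; apply: interlaced_mdist_le => //.
  exact: interleaved_interlaced.
apply: lb_le_inf; first by eexists; exists x.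
by move=> _ [n /Mr/negP + <-]; rewrite -ltNge => /ltW.
Qed.

Theorem theorem17 (R : realType) (X : metricType R) :
  upper_stable X -> property_Q X.
Proof.
move=> [Ku Ku0 stable]; exists (Ku *+ 4); first by rewrite mulrn_wgt0.
move=> k f k1 f_lip; have := Lip_ge0 f; rewrite le0r => /predU1P[Lip0|Lip_gt0].
  exists setT => [|m n _ _]; first exact: infinite_nat.
  by apply: le_trans (mdist_le_Lip f_lip m n) _; rewrite Lip0 mulr0 mul0r.
have lt_r : Ku * Lip f < (Ku * Lip f) *+ 2.
  by rewrite mulr2n ltrDl mulr_gt0.
have [M infM fM] := upper_stable_homogeneous Ku0 stable k1 f_lip lt_r.
exists M => // m n Mm Mn.
have [a ma] := ksub_bounded m; have [b nb] := ksub_bounded n.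
have [p Mp ltp] := ksub_above k (maxn a b) infM.
have mp i j : (m i < p j)%N.
  by apply: leq_ltn_trans (ltp j); rewrite leq_max ma.
have np i j : (n i < p j)%N.
  by apply: leq_ltn_trans (ltp j); rewrite leq_max nb orbT.
apply: le_trans (metric_triangle _ (f p) _) _.
rewrite mulrnAl -[4%N]/(2 + 2)%N mulrnDr; apply: lerD; first exact: fM.
by rewrite metric_sym; apply: fM.
Qed.
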